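(* Every separable metrizable complete uniform space is (uniformly homeomorphic to) the limit of a convergent inverse sequence of separable complete uniform ANRs and uniformly continuous maps.
   Context: A uniform ANR is a metrizable uniform space $Y$ such that for every uniform embedding $i$ of $Y$ onto a closed subspace of a metrizable uniform space $Z$ there exists a uniformly continuous retraction onto $i(Y)$ of some uniform neighborhood of $i(Y)$ in $Z$. A uniform neighborhood of a subset $S$ of a metrizable uniform space is a set containing an $\varepsilon$-neighborhood of $S$ for some $\varepsilon>0$. Given an inverse sequence $X=(\dots\xrightarrow{f_1}X_1\xrightarrow{f_0}X_0)$ of uniformly continuous maps between metrizable uniform spaces, its limit $\varprojlim X$ is the subspace of $\prod_i X_i$ (with the product uniformity) consisting of all threads $(x_i)$ with $f_i(x_{i+1})=x_i$. Write $f^j_i\colon X_j\to X_i$ for the composite bonding maps and $f^\infty_i\colon\varprojlim X\to X_i$ for the projections. Let $X_{\mathbb{N}\cup\infty}$ be the inverse limit of the finite disjoint unions $X_n\sqcup\dots\sqcup X_0$ with bonding maps $X_{n+1}\sqcup X_n\sqcup\dots\sqcup X_0\to X_n\sqcup\dots\sqcup X_0$ equal to $f_n$ on $X_{n+1}$ and to the identity on $X_n\sqcup\dots\sqcup X_0$; it contains $\varprojlim X$ and each $X_i$. The inverse sequence is convergent if every uniform neighborhood of $\varprojlim X$ in $X_{\mathbb{N}\cup\infty}$ contains all but finitely many of the $X_i$'s. Equivalently: for each $i$, each uniform neighborhood of $f^\infty_i(\varprojlim X)$ in $X_i$ contains $f^j_i(X_j)$ for all but finitely many $j$. *)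

(* Defs.v *)
From HB Require Import structures.
From mathcomp Require Import all_boot all_order all_algebra.
From mathcomp Require Import all_classical all_reals.
From mathcomp Require Import topology.

Set Implicit Arguments.
Unset Strict Implicit.
Unset Printing Implicit Defensive.

Import Order.TTheory GRing.Theory Num.Theory.

Local Open Scope classical_set_scope.
Local Open Scope ring_scope.

Definition metrizes (R : realType) (T : uniformType) (d : T -> T -> R) : Prop :=
  [/\ forall x, d x x = 0,
      forall x y, d x y = 0 -> x = y,
      forall x y, d x y = d y x,
      forall y x z, d x z <= d x y + d y z &
      @entourage T = entourage_ (fun x e => [set y | d x y < e])].

Definition metrizable (R : realType) (T : uniformType) : Prop :=
  exists d : T -> T -> R, metrizes d.

Definition separable (T : topologicalType) : Prop :=
  exists2 D : set T, countable D & dense D.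

(* The library's [completeType] only covers pointed spaces; here the empty
   space is allowed. *)
Definition complete_uniform (T : uniformType) : Prop :=
  forall F : set_system T, ProperFilter F -> cauchy F ->
    exists x : T, F --> x.

Definition unif_homeomorphism (S T : uniformType) (h : S -> T) : Prop :=
  unif_continuous h /\
  exists g : T -> S, [/\ unif_continuous g, cancel h g & cancel g h].

Definition unif_homeomorphic (S T : uniformType) : Prop :=
  exists h : S -> T, unif_homeomorphism h.

(* [range i], used as a type, carries the uniformity induced from [Z]. *)
Definition unif_embedding (Y Z : uniformType) (i : Y -> Z) : Prop :=
  exists2 h : Y -> range i,
    unif_homeomorphism h & forall y, set_val (h y) = i y.

(* Stated with entourages, hence independent of the choice of a metric; see
   [unif_neighborhood_metricP]. *)
Definition unif_neighborhood (T : uniformType) (S U : set T) : Prop :=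
  exists2 E, entourage E & forall s, S s -> xsection E s `<=` U.

Lemma unif_neighborhood_metricP (R : realType) (T : uniformType)
    (d : T -> T -> R) (S U : set T) : metrizes d ->
  unif_neighborhood S U <->
  exists2 e : R, 0 < e & [set t | exists2 s, S s & d s t < e] `<=` U.
Proof.
move=> [_ _ _ _ entE]; rewrite /unif_neighborhood entE; split.
  move=> [E [e e0 deE] SEU]; exists e => // t [s Ss dst].
  by apply: (SEU s Ss); apply/xsectionP; exact: deE.
move=> [e e0 SeU]; exists [set xy | d xy.1 xy.2 < e]; first by exists e.
by move=> s Ss t /xsectionP/= dst; apply: SeU; exists s.
Qed.

Definition unif_retraction (Z : uniformType) (U A : set Z) (r : U -> A) : Prop :=
  unif_continuous r /\ forall u : U, A (set_val u) -> set_val (r u) = set_val u.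

Definition uniform_ANR (R : realType) (Y : uniformType) : Prop :=
  metrizable R Y /\
  forall (Z : uniformType) (i : Y -> Z),
    metrizable R Z -> unif_embedding i -> closed (range i) ->
    exists2 U : set Z, unif_neighborhood (range i) U &
      exists r : U -> range i, unif_retraction r.

Definition inverse_limit (X : nat -> uniformType)
    (f : forall n, X n.+1 -> X n) : set (prod_topology X) :=
  [set x | forall n, f n (x n.+1) = x n].

(* The disjoint union of two uniform spaces: a set is an entourage as soon as
   its traces on both summands are. *)
Section sum_uniform.
Context {S T : uniformType}.
Local Open Scope relation_scope.

Definition sum_ent : set_system ((S + T) * (S + T)) :=
  [set E | entourage [set xy : S * S | E (inl xy.1, inl xy.2)] /\
           entourage [set xy : T * T | E (inr xy.1, inr xy.2)]].

Let sum_ent_filter : Filter sum_ent.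
Proof.
split; first by split; exact: filterT.
- by move=> P Q [Pl Pr] [Ql Qr]; split; exact: filterI.
- by move=> P Q PQ [Pl Pr]; split; [apply: filterS Pl|apply: filterS Pr] => xy;
    exact: PQ.
Qed.

Let sum_ent_refl E : sum_ent E -> diagonal `<=` E.
Proof.
by move=> [El Er] [[x|x] y] /diagonalP <-;
  [have := entourage_refl x El|have := entourage_refl x Er].
Qed.

Let sum_ent_inv E : sum_ent E -> sum_ent E^-1.
Proof. by move=> [/entourage_inv El /entourage_inv Er]; split. Qed.

Let sum_ent_split E : sum_ent E -> exists2 B, sum_ent B & B \; B `<=` E.
Proof.
move=> [/entourage_split_ex[A entA AE] /entourage_split_ex[B entB BE]].
exists [set xy | match xy with
  | (inl x, inl y) => A (x, y) | (inr x, inr y) => B (x, y) | _ => False end].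
  split; [apply: filterS entA|apply: filterS entB]; by case.
move=> [[x|x] [y|y]] [[z|z]] //= xz zy.
  by apply: (AE (x, y)); exists z.
by apply: (BE (x, y)); exists z.
Qed.

HB.instance Definition _ := isUniform.Build (S + T)%type
  sum_ent_filter sum_ent_refl sum_ent_inv sum_ent_split.

End sum_uniform.

Section telescope.
Variables (X : nat -> uniformType) (f : forall n, X n.+1 -> X n).

(* X_n + (X_(n-1) + (... + X_0)), with the top summand on the left. *)
Fixpoint partial_union (n : nat) : uniformType :=
  match n with
  | 0 => X 0
  | m.+1 => (X m.+1 + partial_union m)%type
  end.

Definition top_summand (n : nat) : X n -> partial_union n :=
  match n with
  | 0 => fun x => x
  | _.+1 => fun x => inl x
  end.

Definition union_bonding (n : nat) (z : partial_union n.+1) : partial_union n :=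
  match z with
  | inl x => top_summand (f x)
  | inr y => y
  end.

Definition lower_summands (n : nat) : partial_union n -> partial_union n.+1 :=
  fun z => inr z.

(* The space X_{N u oo}, which contains the limit of X and each X_i. *)
Definition telescope_limit : set (prod_topology partial_union) :=
  inverse_limit union_bonding.

Definition limit_in_telescope : set telescope_limit :=
  [set z | exists2 x, inverse_limit f x &
     forall n, set_val z n = top_summand (x n)].

(* A point x of X_i is identified with the thread whose i-th coordinate is x
   and whose n-th coordinate, for n >= i, is the same x, viewed in the summand
   X_i of X_n + ... + X_0; the coordinates below i are then images of x under
   bonding maps.  See [summand_in_telescopeP]. *)
Definition summand_in_telescope (i : nat) : set telescope_limit :=
  [set z | (exists x : X i, set_val z i = top_summand x) /\
     forall n, (i <= n)%N -> set_val z n.+1 = lower_summands (set_val z n)].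

Definition convergent : Prop :=
  forall U : set telescope_limit, unif_neighborhood limit_in_telescope U ->
    \forall i \near \oo, summand_in_telescope i `<=` U.

Lemma summand_in_telescopeP (i : nat) (x : X i) :
  exists! z : telescope_limit,
    summand_in_telescope i z /\ set_val z i = top_summand x.
Proof.
have [y yi yS] : exists2 y : forall n, partial_union n,
    y i = top_summand x & forall n, (n < i)%N -> union_bonding (y n.+1) = y n.
  move: (top_summand x) => {x}; elim: i => [u|i IH u].
    by exists (fix y n : partial_union n :=
      match n with 0 => u | m.+1 => lower_summands (y m) end).
  have [y yi yS] := IH (union_bonding u).
  exists (dfwith y i.+1 u); first by rewrite dfwithin.
  move=> n; rewrite ltnS leq_eqVlt => /predU1P[->|ni].
    by rewrite dfwithin dfwithout ?yi// gtn_eqF.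
  by rewrite !dfwithout ?yS// gtn_eqF// ltnS// ltnW.
pose z := fix z n : partial_union n := match n with
  | 0 => y 0%N
  | m.+1 => if (m < i)%N then y m.+1 else lower_summands (z m) end.
have zy n : (n <= i)%N -> z n = y n by case: n => //= n ->.
have zS n : (i <= n)%N -> z n.+1 = lower_summands (z n) by rewrite /= ltnNge => ->.
have zlim : telescope_limit z.
  move=> n; have [ni|ni] := ltnP n i; last by rewrite zS.
  by rewrite !zy ?yS// ltnW.
exists (SigSub (mem_set zlim)); split.
  have zi : z i = top_summand x by rewrite zy.
  by split=> //; split; [exists x|exact: zS].
move=> w [[_ wS] wi]; apply: val_inj; apply: functional_extensionality_dep => n /=.
have wlim : telescope_limit (set_val w) := set_valP w.
have eqi : z i = set_val w i by rewrite zy// yi wi.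
have [ni|/ltnW/subnK <-] := leqP n i; last first.
  elim: (n - i)%N => [//|k IH]; rewrite addSn zS ?leq_addl//.
  by rewrite IH -wS// leq_addl.
rewrite -(subKn ni); elim: (i - n)%N (leq_subr n i) => [|k IH] ki.
  by rewrite subn0.
have {}IH := IH (ltnW ki); rewrite -(subnSK ki) in IH.
by rewrite -(zlim (i - k.+1)%N) IH; exact: wlim.
Qed.

End telescope.

(* Main.v *)
Require Import Defs.
From mathcomp Require Import all_boot all_order all_algebra.
From mathcomp Require Import all_classical all_reals topology.
From mathcomp Require Import ring lra.

(** Every separable metric space X embeds uniformly into the cube Q of null
    families in [0, 1], with the sup metric, by a simple form of Aharoni's
    embedding [aharoni]: its coordinates are tents over balls centred at a
    dense sequence q, and the i-th tent is cut off near q_0, ..., q_(i-1), so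
    that only finitely many tents of a given size are nonzero at a point, while
    at least one of them is large there.  Let K be the image of X.

    Cut Q into the grid cubes of side 1/M and let [cube_nbhd M K] be the union
    of all the (infinite-dimensional) grid cubes that meet K.  Along M = 2^n
    these sets decrease, they lie within 2^-n of K, and their intersection is
    K because X, hence K, is complete.  So X is the limit of the sequence of
    inclusions between them, and since any point of the n-th set has a point
    of K within 2^-n, the sequence is convergent ([nested_convergent]).  Each
    set is closed in Q ([cube_nbhd_closed]), hence complete and separable.

    It remains to see that N = [cube_nbhd M K] is a uniform ANR.  Let N be
    embedded in Z.  The coordinates of the inclusion of N in Q share a modulus
    of continuity, so McShane's formula extends them all to Z equicontinuously.
    The extended family need not be null, but its upper limit at z is at most
    [excess z], the McShane extension of the zero function; subtracting
    [excess z] and truncating at 0 gives a uniformly continuous map F from Z to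
    Q that is the identity on N ([c0_extension]).  Moreover F z is within about
    2 [excess z] of N.  Finally the map [snap M t] of [0, 1] collapses the
    t-neighbourhood of each grid point to that point and stretches the rest;
    applied to every coordinate it sends each point within t of a grid cube
    into that cube.  With t = 3 [excess z], which vanishes on N, this yields
    the retraction [cube_retract] of a uniform neighbourhood of N onto N.  The
    retraction does not depend on the dimension of the cubes because it acts
    on each coordinate separately. *)

Set Implicit Arguments.
Unset Strict Implicit.
Unset Printing Implicit Defensive.

Import Order.TTheory GRing.Theory Num.Theory numFieldTopology.Exports.

Local Open Scope classical_set_scope.
Local Open Scope ring_scope.

Lemma ex_invn_lt {R : realType} (e : R) :
  0 < e -> exists n : nat, n.+1%:R^-1 < e.
Proof.
by move=> e0; exists (Num.truncn e^-1); rewrite invf_plt ?posrE// truncnS_gt.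
Qed.

(** * Grid cubes in the space of null families *)

Section Cubes.
Context {R : realType} {J : countType}.
Implicit Types x y p : arrow_uniform_type J R.
Implicit Type K : set (arrow_uniform_type J R).

(** The families of interest are nonnegative, so upper bounds are enough. *)
Definition vanishing (y : J -> R) :=
  forall e, 0 < e -> exists s : seq J, forall j, j \notin s -> y j < e.

Definition c0_cube : set (arrow_uniform_type J R) :=
  [set y | (forall j, 0 <= y j <= 1) /\ vanishing y].

(** No grid point m/M lies strictly between x_j and y_j, for any j: some closed
    grid cube contains both points.  The sign condition refers to no choice of
    a cube and is inherited by coarser grids. *)
Definition same_cell (M : nat) x y :=
  forall j m, 0 <= (x j - m%:R / M%:R) * (y j - m%:R / M%:R).

Definition cube_nbhd (M : nat) K : set (arrow_uniform_type J R) :=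
  [set y | c0_cube y /\ exists2 x, K x & same_cell M x y].

Lemma sub_cube_nbhd M K : K `<=` c0_cube -> K `<=` cube_nbhd M K.
Proof.
move=> Kc x Kx; split; first exact: Kc.
by exists x => // j m; rewrite -expr2 sqr_ge0.
Qed.

Lemma cube_nbhdM M N K : (0 < M)%N -> (0 < N)%N ->
  cube_nbhd (M * N) K `<=` cube_nbhd M K.
Proof.
move=> M0 N0 y [yc [x Kx xy]]; split=> //; exists x => // j m.
have := xy j (m * N)%N; rewrite !natrM -mulf_div divff ?mulr1//.
by rewrite pnatr_eq0 -lt0n.
Qed.

Lemma grid_floor M (a : R) : (0 < M)%N -> 0 <= a -> exists m : nat,
  m%:R / M%:R <= a < m%:R / M%:R + M%:R^-1.
Proof.
move=> M0 a0; have Mgt0 : 0 < M%:R :> R by rewrite ltr0n.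
exists (Num.truncn (a * M%:R)).
have /andP[h1 h2] := truncn_itv (mulr_ge0 a0 (ltW Mgt0)).
rewrite ler_pdivrMr// h1/= -[X in _ + X]mul1r -mulrDl ltr_pdivlMr//.
by rewrite -(natr1 (Num.truncn _)) in h2.
Qed.

(** The neighbours of the grid point below x_j confine y_j to an interval of
    length 1/M on either side of x_j. *)
Lemma cube_nbhd_near M K y : (0 < M)%N -> K `<=` c0_cube -> cube_nbhd M K y ->
  exists2 x, K x & forall j, `|x j - y j| <= M%:R^-1.
Proof.
move=> M0 Kc [[y01 _] [x Kx xy]]; exists x => // j.
have e0 : 0 < M%:R^-1 :> R by rewrite invr_gt0 ltr0n.
have [/(_ j)/andP[x0 x1] _] := Kc _ Kx; have /andP[y0 y1] := y01 j.
have [m /andP[xm mx]] := grid_floor M0 x0.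
have SE k : k.+1%:R / M%:R = k%:R / M%:R + M%:R^-1 :> R.
  by rewrite -natr1 mulrDl mul1r.
have hS := xy j m.+1; rewrite SE in hS.
have yle : y j <= m%:R / M%:R + M%:R^-1.
  rewrite leNgt; apply/negP => h; move: hS.
  by rewrite nmulr_rge0 ?subr_lt0// => ?; lra.
rewrite ler_norml; apply/andP; split; first lra.
have [xm'|xm'] := ltP (m%:R / M%:R) (x j).
  have := xy j m; rewrite pmulr_rge0 ?subr_gt0// => ?; lra.
case: m {hS yle} xm mx xm' => [|k] xm mx xm'.
  by move: xm'; rewrite mul0r; lra.
rewrite SE in xm mx xm'.
have := xy j k; rewrite pmulr_rge0; last by lra.
lra.
Qed.

Lemma grid_gap_at M (a : R) : (0 < M)%N -> 0 <= a -> exists2 r, 0 < r &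
  forall m, a = m%:R / M%:R \/ r <= `|a - m%:R / M%:R|.
Proof.
move=> M0 a0; have [k /andP[ka ak]] := grid_floor M0 a0.
have e0 : 0 < M%:R^-1 :> R by rewrite invr_gt0 ltr0n.
have SE n : n.+1%:R / M%:R = n%:R / M%:R + M%:R^-1 :> R.
  by rewrite -natr1 mulrDl mul1r.
have low m : (m < k)%N -> m%:R / M%:R + M%:R^-1 <= k%:R / M%:R :> R.
  by rewrite -SE => mk; rewrite ler_pM2r// ler_nat.
have high m : (k < m)%N -> k%:R / M%:R + M%:R^-1 <= m%:R / M%:R :> R.
  by rewrite -SE => mk; rewrite ler_pM2r// ler_nat.
have [ka'|ka'] := ltP (k%:R / M%:R) a.
  exists (Num.min (a - k%:R / M%:R) (k%:R / M%:R + M%:R^-1 - a)).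
    by rewrite lt_min; apply/andP; split; lra.
  move=> m; right; rewrite ge_min; apply/orP; have [mk|km] := leqP m k.
    left; rewrite ger0_norm; last first.
      by move: mk; rewrite leq_eqVlt => /predU1P[->|/low]; lra.
    by move: mk; rewrite leq_eqVlt => /predU1P[->|/low]; lra.
  by right; rewrite ltr0_norm; have := high _ km; lra.
exists M%:R^-1 => // m; case: (ltngtP m k) => [/low mk|/high km|->].
- by right; rewrite ger0_norm; lra.
- by right; rewrite ltr0_norm; lra.
- by left; lra.
Qed.

(** Only finitely many coordinates of y reach 1/(2M), and the others stay away
    from every positive grid point.  The grid point 0 is excluded because a
    null family accumulates there. *)
Lemma grid_gap M y : (0 < M)%N -> c0_cube y -> exists2 r, 0 < r &
  forall j m, (0 < m)%N -> y j = m%:R / M%:R \/ r <= `|y j - m%:R / M%:R|.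
Proof.
move=> M0 [y01 yv]; have e0 : 0 < M%:R^-1 :> R by rewrite invr_gt0 ltr0n.
have [s sP] := yv (M%:R^-1 / 2) (divr_gt0 e0 (ltr0n _ 2)).
have [r r0 rP] : exists2 r, 0 < r & forall j, j \in s -> forall m,
    y j = m%:R / M%:R \/ r <= `|y j - m%:R / M%:R|.
  elim: s {sP} => [|j s [r r0 IH]]; first by exists 1.
  have /andP[yj0 _] := y01 j; have [r' r'0 r'P] := grid_gap_at M0 yj0.
  exists (Num.min r r'); first by rewrite lt_min r0.
  move=> k; rewrite inE => /predU1P[->|ks] m.
    by have [|h] := r'P m; [left|right; rewrite ge_min h orbT].
  by have [|h] := IH _ ks m; [left|right; rewrite ge_min h].
exists (Num.min r (M%:R^-1 / 2)); first by rewrite lt_min r0/= divr_gt0.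
move=> j m m0; have [js|js] := boolP (j \in s).
  by have [|h] := rP _ js m; [left|right; rewrite ge_min h].
right; rewrite ge_min; apply/orP; right; have yj := sP _ js.
have : M%:R^-1 <= m%:R / M%:R :> R by rewrite ler_peMl ?ler1n// ltW.
by move=> h; rewrite ltr0_norm; lra.
Qed.

Lemma c0_cube_closed y :
  (forall e, 0 < e -> exists2 p, c0_cube p & forall j, `|y j - p j| <= e) ->
  c0_cube y.
Proof.
move=> h; split=> [j|e e0].
  apply/andP; split; apply/ler_addgt0Pr => e e0.
    by have [p [/(_ j) p01 _] /(_ j)] := h e e0; rewrite ler_norml; lra.
  by have [p [/(_ j) p01 _] /(_ j)] := h e e0; rewrite ler_norml; lra.
have [p [_ pv] yp] := h (e / 2) (divr_gt0 e0 (ltr0n _ 2)).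
have [s sP] := pv (e / 2) (divr_gt0 e0 (ltr0n _ 2)).
by exists s => j /sP; have := yp j; rewrite ler_norml; lra.
Qed.

(** If p is in the neighbourhood and close enough to y, then p_j and y_j lie on
    the same side of each positive grid point other than y_j, so every grid
    cube that contains p also contains y. *)
Lemma cube_nbhd_closed M K y : (0 < M)%N -> K `<=` c0_cube ->
  (forall e, 0 < e ->
    exists2 p, cube_nbhd M K p & forall j, `|y j - p j| <= e) ->
  cube_nbhd M K y.
Proof.
move=> M0 Kc h; have yc : c0_cube y.
  by apply: c0_cube_closed => e /h[p [pc _] ?]; exists p.
split=> //; have [r r0 rP] := grid_gap M0 yc.
have [p [_ [x Kx xp]] yp] := h (r / 2) (divr_gt0 r0 (ltr0n _ 2)).
exists x => // j [|m].
  rewrite mul0r !subr0 mulr_ge0//; last by have /andP[] := yc.1 j.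
  by have [/(_ j)/andP[]] := Kc _ Kx.
have [->|] := rP j m.+1 isT; first by rewrite subrr mulr0.
have := xp j m.+1; set g := m.+1%:R / M%:R => xpg yg.
have := yp j; rewrite ler_norml => ypj.
have [gy|gy|<-] := ltgtP g (y j); last by rewrite subrr mulr0.
  rewrite gtr0_norm ?subr_gt0// in yg.
  rewrite pmulr_lge0; last lra.
  by rewrite pmulr_lge0 in xpg; lra.
rewrite ltr0_norm ?subr_lt0// in yg.
rewrite nmulr_lge0; last lra.
by rewrite nmulr_lge0 in xpg; lra.
Qed.

End Cubes.

(** * Collapsing neighbourhoods of the grid points of the interval *)

Lemma max_lip {R : realType} (a x y : R) :
  `|Num.max a x - Num.max a y| <= `|x - y|.
Proof.
have := ler_norm (x - y); have := ler_norm (y - x).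
rewrite (distrC y) ler_norml.
by rewrite /Order.max; case: ltP => ?; case: ltP => ?; lra.
Qed.

Lemma min_lip {R : realType} (a x y : R) :
  `|Num.min a x - Num.min a y| <= `|x - y|.
Proof.
have := ler_norm (x - y); have := ler_norm (y - x).
rewrite (distrC y) ler_norml.
by rewrite /Order.min; case: ltP => ?; case: ltP => ?; lra.
Qed.

Section Snap.
Context {R : realType}.
Variable M : nat.
Hypothesis M0 : (0 < M)%N.
Let e : R := M%:R^-1.

(** For t = 0 this is the clamp of u to [0, e].  For 0 < t <= e / 4 the slope
    1 + 4 M t about the midpoint is steep enough for the clamp to be constant
    on both [0, t] and [e - t, e]; unlike the exact slope e / (e - 2 t), it is
    affine in t. *)
Definition ramp (t u : R) : R :=
  Num.max 0 (Num.min e (e / 2 + (u - e / 2) * (1 + 4 * M%:R * t))).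

(** For t <= e / 4 this is a monotone map of [0, 1] onto itself that sends the
    t-neighbourhood of each grid point to that point, and it is the identity
    for t = 0. *)
Definition snap (t s : R) : R := \sum_(m < M) ramp t (s - m%:R * e).

Let Mgt0 : 0 < M%:R :> R. Proof. by rewrite ltr0n. Qed.
Let Me : M%:R * e = 1. Proof. by rewrite mulfV// gt_eqF. Qed.
Let e0 : 0 < e. Proof. by rewrite invr_gt0. Qed.

Lemma ramp_ge0 t u : 0 <= ramp t u.
Proof. by rewrite /ramp le_max lexx. Qed.

Lemma ramp_le t u : ramp t u <= e.
Proof. by rewrite /ramp ge_max ge_min lexx/= ltW. Qed.

Lemma ramp_eq0 t u : 0 <= t <= e / 4 -> u <= t -> ramp t u = 0.
Proof.
move=> /andP[t0 te] ut; apply/max_idPl; rewrite ge_min; apply/orP; right.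
have Mt : M%:R * t <= 1 / 4.
  by rewrite (le_trans (ler_wpM2l _ te)) ?mulrA ?Me// ltW.
have : 0 <= (e / 2 - u - (e / 2 - t)) * (1 + 4 * (M%:R * t)).
  by rewrite mulr_ge0//; have := mulr_ge0 (ltW Mgt0) t0; lra.
have : 0 <= t * (1 - 4 * (M%:R * t)) by rewrite mulr_ge0//; lra.
have : e * (M%:R * t) = t by rewrite mulrA (mulrC e) Me mul1r.
nra.
Qed.

Lemma ramp_eq t u : 0 <= t <= e / 4 -> e - t <= u -> ramp t u = e.
Proof.
move=> /andP[t0 te] ut; rewrite /ramp.
suff /min_idPl -> : e <= e / 2 + (u - e / 2) * (1 + 4 * M%:R * t).
  by apply/max_idPr/ltW.
have Mt : M%:R * t <= 1 / 4.
  by rewrite (le_trans (ler_wpM2l _ te)) ?mulrA ?Me// ltW.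
have : 0 <= (u - e / 2 - (e / 2 - t)) * (1 + 4 * (M%:R * t)).
  by rewrite mulr_ge0//; have := mulr_ge0 (ltW Mgt0) t0; lra.
have : 0 <= t * (1 - 4 * (M%:R * t)) by rewrite mulr_ge0//; lra.
have : e * (M%:R * t) = t by rewrite mulrA (mulrC e) Me mul1r.
nra.
Qed.

Lemma ramp_le2 t u : 0 <= t <= e / 4 -> 0 <= u -> ramp t u <= 2 * u.
Proof.
move=> /andP[t0 te] u0; rewrite /ramp ge_max ge_min mulr_ge0//=.
have Mt : M%:R * t <= 1 / 4.
  by rewrite (le_trans (ler_wpM2l _ te)) ?mulrA ?Me// ltW.
apply/orP; right; have : 0 <= u * (1 - 4 * (M%:R * t)).
  by rewrite mulr_ge0//; lra.
have : e * (M%:R * t) = t by rewrite mulrA (mulrC e) Me mul1r.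
nra.
Qed.

Lemma ramp0 u : ramp 0 u = Num.max 0 (Num.min e u).
Proof. by rewrite /ramp mulr0 addr0 mulr1 addrC subrK. Qed.

Lemma ramp_lip t t' u u' : 0 <= t <= e / 4 -> 0 <= t' <= e / 4 ->
  `|u| <= 1 -> `|u'| <= 1 ->
  `|ramp t u - ramp t' u'| <= 2 * `|u - u'| + 8 * M%:R * `|t - t'|.
Proof.
move=> /andP[t0 te] /andP[t0' te'] u1 u1'.
apply: le_trans (max_lip _ _ _) _; apply: le_trans (min_lip _ _ _) _.
rewrite (_ : _ - _ = (u - u') * (1 + 4 * (M%:R * t))
   + (u' - e / 2) * (4 * M%:R) * (t - t')); last by ring.
have Mt : M%:R * t <= 1 / 4.
  by rewrite (le_trans (ler_wpM2l _ te)) ?mulrA ?Me// ltW.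
have Mt0 := mulr_ge0 (ltW Mgt0) t0.
have e1 : e <= 1 by rewrite invf_le1// ler1n.
apply: le_trans (ler_normD _ _) _; rewrite !normrM; apply: lerD.
  by rewrite mulrC ler_wpM2r// ger0_norm; lra.
rewrite ler_wpM2r// (ger0_norm (x := 4))// (ger0_norm (ltW Mgt0)) mulrA.
rewrite ler_wpM2r ?(ltW Mgt0)//.
have : `|u' - e / 2| <= 2.
  by apply: le_trans (ler_normB _ _) _; rewrite (ger0_norm (x := e / 2)); lra.
lra.
Qed.

Lemma snap_itv t s : 0 <= snap t s <= 1.
Proof.
rewrite sumr_ge0/=; last by move=> m _; exact: ramp_ge0.
rewrite (_ : 1 = \sum_(m < M) e); last first.
  by rewrite sumr_const card_ord -mulr_natl Me.
by apply: ler_sum => m _; exact: ramp_le.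
Qed.

(** The ramps over the cells below the grid point are saturated. *)
Lemma snap_ge t s m : 0 <= t <= e / 4 -> s <= 1 -> m%:R * e - t <= s ->
  m%:R * e <= snap t s.
Proof.
move=> tle s1 ms; have /andP[t0 te] := tle.
have [mM|Mm] := leqP m M; last first.
  have : M.+1%:R * e <= m%:R * e by rewrite ler_wpM2r ?ler_nat// ltW.
  rewrite -addn1 natrD mulrDl Me mul1r => ?; have := e0; lra.
rewrite /snap (big_ord_widen_cond _ xpredT
  (fun k => ramp t (s - k%:R * e)) (leqnn M)).
rewrite (bigID (fun k : 'I_M => (k < m)%N))/=.
rewrite -[leLHS]addr0 lerD//; last by apply: sumr_ge0 => k _; exact: ramp_ge0.
rewrite (eq_bigl (fun k : 'I_M => (k < m)%N)); last first.
  by move=> k; rewrite ltn_ord.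
rewrite -(big_ord_widen _ (fun k => ramp t (s - k%:R * e)) mM).
rewrite -[m in leLHS]card_ord mulr_natl -sumr_const.
apply: ler_sum => k _; rewrite ramp_eq//.
have : (k.+1)%:R * e <= m%:R * e by rewrite ler_wpM2r ?ler_nat// ltW.
by rewrite -addn1 natrD mulrDl mul1r => ?; lra.
Qed.

(** The ramps over the cells above the grid point vanish. *)
Lemma snap_le t s m : 0 <= t <= e / 4 -> s <= m%:R * e + t ->
  snap t s <= m%:R * e.
Proof.
move=> tle ms; have /andP[t0 te] := tle.
have [Mm|mM] := leqP M m.
  have /andP[_ s1] := snap_itv t s; apply: le_trans s1 _.
  by rewrite -[leLHS]Me ler_wpM2r ?ler_nat// ltW.
rewrite /snap (bigID (fun k : 'I_M => (k < m)%N))/= [X in _ + X]big1 ?addr0.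
  rewrite -(big_ord_widen _ (fun k => ramp t (s - k%:R * e)) (ltnW mM)).
  rewrite -[m in leRHS]card_ord mulr_natl -sumr_const.
  by apply: ler_sum => k _; exact: ramp_le.
move=> k; rewrite -leqNgt => mk; apply: ramp_eq0 => //.
have : m%:R * e <= k%:R * e by rewrite ler_wpM2r ?ler_nat// ltW.
lra.
Qed.

Lemma snap0 s : 0 <= s <= 1 -> snap 0 s = s.
Proof.
move=> /andP[s0 s1].
have H k : \sum_(m < k) ramp 0 (s - m%:R * e) = Num.min s (k%:R * e).
  elim: k => [|k IH]; first by rewrite big_ord0 mul0r; apply/esym/min_idPr.
  rewrite big_ord_recr/= IH ramp0 -addn1 natrD mulrDl mul1r /Order.min.
  have := e0; case: (ltP s (k%:R * e)) => ? ?;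
    case: (ltP e (s - k%:R * e)) => ?; rewrite /Order.max;
    by repeat case: ltP => ?; lra.
by rewrite /snap H Me; apply/min_idPl.
Qed.

(** Linear growth at 0, which makes the coordinatewise snap preserve null
    families. *)
Lemma snap_small t s : 0 <= t <= e / 4 -> 0 <= s -> snap t s <= 2 * M%:R * s.
Proof.
move=> te s0; rewrite /snap -mulrA mulrCA.
rewrite -[M in leRHS](card_ord M) mulr_natl -sumr_const.
apply: ler_sum => k _; have [ks|sk] := leP (k%:R * e) s.
  apply: le_trans (ramp_le2 te _) _; first by rewrite subr_ge0.
  by rewrite ler_pM2l// lerBlDr lerDl mulr_ge0// ltW.
rewrite ramp_eq0 ?mulr_ge0//; have /andP[t0 _] := te; lra.
Qed.

Lemma snap_lip t t' s s' : 0 <= t <= e / 4 -> 0 <= t' <= e / 4 ->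
  0 <= s <= 1 -> 0 <= s' <= 1 ->
  `|snap t s - snap t' s'| <= M%:R * (2 * `|s - s'| + 8 * M%:R * `|t - t'|).
Proof.
move=> te te' /andP[s0 s1] /andP[s0' s1']; rewrite /snap -sumrB.
rewrite -[M in leRHS](card_ord M) mulr_natl -sumr_const.
apply: le_trans (ler_norm_sum _ _ _) _; apply: ler_sum => k _.
have k0 : 0 <= k%:R * e by rewrite mulr_ge0// ltW.
have k1 : k%:R * e <= 1.
  by rewrite -[leRHS]Me ler_wpM2r ?(ltW e0)// ler_nat ltnW.
rewrite (_ : s - s' = (s - k%:R * e) - (s' - k%:R * e)); last by ring.
by rewrite card_ord; apply: ramp_lip => //; rewrite ler_norml; lra.
Qed.
End Snap.

(** * Extension of uniformly continuous maps into the space of null families *)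

Section Extension.
Context {R : realType} {Z I : Type} {J : countType}.
Variables (d : Z -> Z -> R) (i : I -> Z) (f : I -> J -> R).
Hypothesis dxx : forall x, d x x = 0.
Hypothesis dC : forall x y, d x y = d y x.
Hypothesis dD : forall y x z, d x z <= d x y + d y z.
Hypothesis f01 : forall a j, 0 <= f a j <= 1.

(** The modulus is shared by all coordinates of f, as sup-norm continuity
    provides. *)
Definition modulus (e r : R) :=
  [/\ 0 < e, 0 < r &
      forall a b, d (i a) (i b) < r -> forall j, `|f a j - f b j| <= e].

Hypothesis f_unif : forall e, 0 < e -> exists r, modulus e r.

Let d_ge0 x y : 0 <= d x y.
Proof. have := dD y x x; rewrite dxx (dC y x); lra. Qed.

(** In McShane's formula f a j + w is an upper bound for the extension of f_j at
    z.  The lines e + s / r over all moduli (e, r) have as infimum a concave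
    modulus of continuity of f; working with the lines themselves avoids that
    infimum. *)
Definition slack (z : Z) (a : I) (w : R) :=
  exists e r, modulus e r /\ w = e + d (i a) z / r.

Lemma slack_gt0 z a w : slack z a w -> 0 < w.
Proof.
by move=> [e [r [[e0 r0 _] ->]]]; rewrite ltr_wpDr// divr_ge0// ltW.
Qed.

(** Subadditivity of the concave modulus: among two lines, the flatter one
    bounds the sum. *)
Lemma slack_step z z' a w e r : slack z a w -> modulus e r ->
  exists2 w', slack z' a w' & w' <= w + (e + d z z' / r).
Proof.
move=> [e1 [r1 [m1 ->]]] m; have [e10 r10 _] := m1; have [e0 r0 _] := m.
have [rr|rr] := leP r r1.
  exists (e1 + d (i a) z' / r1); first by exists e1, r1.
  have : d (i a) z' / r1 <= d (i a) z / r1 + d z z' / r1.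
    by rewrite -mulrDl ler_pM2r ?invr_gt0//.
  have : d z z' / r1 <= d z z' / r by rewrite ler_wpM2l// lef_pV2.
  lra.
exists (e + d (i a) z' / r); first by exists e, r.
have : d (i a) z' / r <= d (i a) z / r + d z z' / r.
  by rewrite -mulrDl ler_pM2r ?invr_gt0//.
have : d (i a) z / r <= d (i a) z / r1 by rewrite ler_wpM2l// lef_pV2// ltW.
lra.
Qed.

(** Where the modulus says nothing, d (i a) (i b) / r is at least 1, which
    bounds the oscillation of a map into [0, 1]. *)
Lemma slack_lip j a b w : slack (i b) a w -> f b j <= f a j + w.
Proof.
move=> [e [r [[e0 r0 m] ->]]]; have [ab|ab] := ltP (d (i a) (i b)) r.
  have := m a b ab j; have := divr_ge0 (d_ge0 (i a) (i b)) (ltW r0).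
  by rewrite ler_norml; lra.
have : 1 <= d (i a) (i b) / r by rewrite ler_pdivlMr// mul1r.
by have := f01 a j; have := f01 b j; lra.
Qed.

(** The value 1 truncates the extension and keeps this set nonempty when I is
    empty. *)
Definition mcshane_bounds (g : I -> R) (z : Z) : set R :=
  [set 1] `|` [set c | exists a w, slack z a w /\ c = g a + w].

Definition mcshane (g : I -> R) (z : Z) : R := inf (mcshane_bounds g z).

Section one_function.
Variable g : I -> R.
Hypothesis g0 : forall a, 0 <= g a.
Hypothesis g1 : forall a, g a <= 1.
Hypothesis g_slack : forall a b w, slack (i b) a w -> g b <= g a + w.

Let bounds_lb z : has_lbound (mcshane_bounds g z).
Proof.
rewrite /mcshane_bounds; exists 0 => _ [->//|[a [w [/slack_gt0 w0 ->]]]].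
by rewrite addr_ge0// ltW.
Qed.

Lemma mcshane_le z a w : slack z a w -> mcshane g z <= g a + w.
Proof. by move=> h; apply: ge_inf => //; right; exists a, w. Qed.

Lemma mcshane_le1 z : mcshane g z <= 1.
Proof. by apply: (ge_inf (bounds_lb z)); left. Qed.

Lemma le_mcshane z c : c <= 1 -> (forall a w, slack z a w -> c <= g a + w) ->
  c <= mcshane g z.
Proof.
move=> c1 h; apply: lb_le_inf; first by exists 1; left.
by move=> _ [->//|[a [w [/h ? ->]]]].
Qed.

Lemma mcshane_ge0 z : 0 <= mcshane g z.
Proof.
by apply: le_mcshane => // a w /slack_gt0 w0; rewrite addr_ge0// ltW.
Qed.

Lemma mcshane_lt z c : c <= 1 -> mcshane g z < c ->
  exists a w, slack z a w /\ g a + w < c.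
Proof.
move=> c1 zc; have hi : mcshane_bounds g z !=set0 by exists 1; left.
have [_ [->|[a [w [h ->]]]] wc] := inf_lt hi zc.
  by have := lt_le_trans wc c1; rewrite ltxx.
by exists a, w.
Qed.

Lemma mcshane_ext a : mcshane g (i a) = g a.
Proof.
apply/eqP; rewrite eq_le; apply/andP; split; last first.
  by apply: le_mcshane => // b w h; exact: g_slack h.
apply/ler_addgt0Pr => e e0; apply: mcshane_le.
by have [r m] := f_unif e0; exists e, r; rewrite dxx mul0r addr0.
Qed.

Lemma mcshane_unif z z' e r : modulus e r ->
  mcshane g z' <= mcshane g z + (e + d z z' / r).
Proof.
move=> m; rewrite -lerBlDr; have [e0 r0 _] := m.
have h0 : 0 <= d z z' / r by rewrite divr_ge0// ltW.
apply: le_mcshane; first by have := mcshane_le1 z'; lra.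
move=> a w /slack_step/(_ m)-/(_ z')[w' /mcshane_le]; lra.
Qed.

End one_function.

Let coord_ge0 j a : 0 <= f a j. Proof. by have /andP[] := f01 a j. Qed.
Let coord_le1 j a : f a j <= 1. Proof. by have /andP[] := f01 a j. Qed.

(** This vanishes on the image of i and bounds the upper limit over j of the
    extended coordinates: each of them is at most f a j + w, for any slack w,
    and f a is null. *)
Definition excess (z : Z) : R := mcshane (fun=> 0) z.

Lemma excess_ge0 z : 0 <= excess z.
Proof. exact: mcshane_ge0. Qed.

Lemma excess_le z a w : slack z a w -> excess z <= w.
Proof. by move=> /(mcshane_le (fun=> lexx 0)); rewrite add0r. Qed.

Lemma excess_lt z c : c <= 1 -> excess z < c ->
  exists a w, slack z a w /\ w < c.
Proof.
move=> c1 /(mcshane_lt c1)[a [w [aw]]]; rewrite add0r => wc.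
by exists a, w.
Qed.

Lemma excess_ext a : excess (i a) = 0.
Proof.
by apply: mcshane_ext => //= b c w /slack_gt0/ltW; rewrite add0r.
Qed.

Lemma excess_unif z z' e r : modulus e r ->
  `|excess z - excess z'| <= e + d z z' / r.
Proof.
move=> m; rewrite ler_norml.
have := mcshane_unif (fun=> lexx 0) z z' m.
have := mcshane_unif (fun=> lexx 0) z' z m.
by rewrite (dC z') -/(excess z) -/(excess z'); lra.
Qed.

Definition c0_extension (z : Z) : J -> R :=
  fun j => Num.max 0 (mcshane (f^~ j) z - excess z).

Lemma c0_extension01 z j : 0 <= c0_extension z j <= 1.
Proof.
rewrite /c0_extension le_max lexx/= ge_max ler01/=.
have := mcshane_le1 (coord_ge0 j) z; have := excess_ge0 z; lra.
Qed.

Lemma c0_extension_ext a j : c0_extension (i a) j = f a j.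
Proof.
rewrite /c0_extension excess_ext subr0.
rewrite (mcshane_ext (coord_ge0 j) (coord_le1 j) (slack_lip j)).
exact/max_idPr.
Qed.

Lemma c0_extension_near z a w j : slack z a w ->
  `|c0_extension z j - f a j| <= 2 * w.
Proof.
move=> aw; have h1 := mcshane_le (coord_ge0 j) aw.
have h2 := excess_le aw; have h3 := excess_ge0 z.
have w0 := slack_gt0 aw; have f0 := coord_ge0 j a.
have h4 : f a j - w <= mcshane (f^~ j) z.
  have [e [r [m ->]]] := aw.
  have := mcshane_unif (coord_ge0 j) z (i a) m.
  rewrite (mcshane_ext (coord_ge0 j) (coord_le1 j) (slack_lip j)).
  by rewrite (dC z); lra.
rewrite /c0_extension ler_norml /Order.max.
by case: ltP => ?; apply/andP; split; lra.
Qed.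

Lemma c0_extension_unif z z' e r j : modulus e r ->
  `|c0_extension z j - c0_extension z' j| <= 2 * (e + d z z' / r).
Proof.
move=> m; have := excess_unif z z' m.
have := mcshane_unif (coord_ge0 j) z z' m.
have := mcshane_unif (coord_ge0 j) z' z m.
rewrite (dC z') /c0_extension !ler_norml.
have [e0 r0 _] := m; have := divr_ge0 (d_ge0 z z') (ltW r0).
rewrite /Order.max; case: ltP => ?; case: ltP => ?; lra.
Qed.

(** If 1 is less than [excess z + e], truncation at 1 bounds all coordinates by
    e; otherwise some slack w at a is less than [excess z + e / 2], and the
    coordinate j, once [excess z] is subtracted, is at most f a j + e / 2. *)
Lemma c0_extension_vanishing z : (forall a, vanishing (f a)) ->
  vanishing (c0_extension z).
Proof.
move=> fv e e0; have [c1|c1] := ltP 1 (excess z + e).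
  exists [::] => j _; rewrite /c0_extension gt_max e0/=.
  have := mcshane_le1 (coord_ge0 j) z; lra.
have [] := @excess_lt z (excess z + e / 2) _ _; [lra|lra|].
move=> a [w [aw we]]; have [s sP] := fv a (e / 2) (divr_gt0 e0 (ltr0n _ 2)).
exists s => j /sP fj; rewrite /c0_extension gt_max e0/=.
have := mcshane_le (coord_ge0 j) aw; lra.
Qed.

End Extension.

(** * The retraction onto a union of grid cubes *)

Section Retraction.
Context {R : realType} {J : countType} {Z I : Type}.
Variables (M : nat) (K : set (arrow_uniform_type J R)).
Hypothesis M0 : (0 < M)%N.
Hypothesis Kc : K `<=` c0_cube.
Variables (d : Z -> Z -> R) (i : I -> Z) (f : I -> arrow_uniform_type J R).
Hypothesis dxx : forall x, d x x = 0.
Hypothesis dC : forall x y, d x y = d y x.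
Hypothesis dD : forall y x z, d x z <= d x y + d y z.
Hypothesis f_cube : forall a, cube_nbhd M K (f a).
Hypothesis f_unif : forall e, 0 < e -> exists r, modulus d i f e r.

Let f01 a j : 0 <= f a j <= 1. Proof. exact: (f_cube a).1.1. Qed.

Let Mgt0 : 0 < M%:R :> R. Proof. by rewrite ltr0n. Qed.
Let e0 : 0 < M%:R^-1 :> R. Proof. by rewrite invr_gt0. Qed.

(** The bound makes the collapsing radius 3 [excess z] at most a quarter of the
    side of a grid cube. *)
Definition retract_domain : set Z :=
  [set z | excess d i f z <= M%:R^-1 / 12].

Definition cube_retract (z : Z) : arrow_uniform_type J R :=
  fun j => snap M (3 * excess d i f z) (c0_extension d i f z j).

Let collapse_itv z : retract_domain z ->
  0 <= 3 * excess d i f z <= M%:R^-1 / 4.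
Proof.
by rewrite /retract_domain/= => h; have := excess_ge0 i f dxx dC dD z; lra.
Qed.

Lemma cube_retract_ext a : cube_retract (i a) = f a.
Proof.
apply/funext => j; rewrite /cube_retract c0_extension_ext// excess_ext//.
by rewrite mulr0 snap0.
Qed.

(** Some slack w at a is less than 3/2 [excess z] when the latter is positive,
    and then the extension at z is within 2 w, hence within the collapsing
    radius, of a point of the neighbourhood; snapping moves it into the cube
    of that point.  When [excess z] is 0 the extension at z is a limit of points
    of the neighbourhood, which is closed. *)
Lemma cube_retract_in z : retract_domain z -> cube_nbhd M K (cube_retract z).
Proof.
move=> Dz; have tz := collapse_itv Dz.
have F01 := c0_extension01 i dxx dC dD f01 z.
have H01 j : 0 <= cube_retract z j <= 1 by exact: snap_itv.
have Hv : vanishing (cube_retract z).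
  move=> e e_gt0; have c0 : 0 < e / (2 * M%:R) by rewrite divr_gt0// mulr_gt0.
  have Fv := c0_extension_vanishing i dxx dC dD f01 z (fun a => (f_cube a).1.2).
  have [s sP] := Fv _ c0.
  exists s => j /sP; rewrite ltr_pdivlMr ?mulr_gt0// mulrC.
  by apply: le_lt_trans; apply: snap_small => //; have /andP[] := F01 j.
have [L0|L0] := eqVneq (excess d i f z) 0.
  have -> : cube_retract z = c0_extension d i f z.
    by apply/funext => j; rewrite /cube_retract L0 mulr0 snap0.
  apply: cube_nbhd_closed => // e e_gt0.
  have [||a [w [aw we]]] := @excess_lt _ _ _ _ d i f z (Num.min 1 (e / 2)).
  - by rewrite ge_min lexx.
  - by rewrite L0 lt_min ltr01 divr_gt0.
  exists (f a) => // j.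
  apply: le_trans (c0_extension_near dxx dC dD f01 f_unif j aw) _.
  by move: we; rewrite lt_min => /andP[_]; lra.
have {}L0 : 0 < excess d i f z by rewrite lt_neqAle eq_sym L0 excess_ge0.
have e1 : M%:R^-1 <= 1 :> R by rewrite invf_le1// ler1n.
have [||a [w [aw we]]] := @excess_lt _ _ _ _ d i f z (3 / 2 * excess d i f z).
- by move: Dz; rewrite /retract_domain/=; lra.
- lra.
split=> //; have [_ [x Kx xf]] := f_cube a; exists x => // j m.
have := c0_extension_near dxx dC dD f01 f_unif j aw; rewrite ler_norml => Ff.
have := xf j m; set g := m%:R / M%:R => xfg.
have [gx|xg|->] := ltgtP g (x j); last by rewrite subrr mul0r.
  rewrite pmulr_rge0 ?subr_gt0// subr_ge0 in xfg.
  rewrite pmulr_rge0 ?subr_gt0// subr_ge0.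
  by apply: (snap_ge M0); rewrite -/g//; have := F01 j; lra.
rewrite nmulr_rge0 ?subr_lt0// subr_le0 in xfg.
rewrite nmulr_rge0 ?subr_lt0// subr_le0.
by apply: (snap_le M0); rewrite -/g//; lra.
Qed.

Lemma cube_retract_unif e : 0 < e -> exists2 r, 0 < r &
  forall z z', retract_domain z -> retract_domain z' -> d z z' < r ->
  forall j, `|cube_retract z j - cube_retract z' j| < e.
Proof.
(* C collects the Lipschitz constant of the snap with respect to the bounds on
   the variation of the extension (factor 2) and of the radius (factor 3). *)
move=> e_gt0; pose C : R := M%:R * (4 + 24 * M%:R).
have C0 : 0 < C by rewrite mulr_gt0// addr_gt0// mulr_gt0.
have [r m] := f_unif (divr_gt0 (divr_gt0 e_gt0 (ltr0n R 2)) C0).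
have [c0 r0 _] := m.
exists (e / 2 / C * r); first by rewrite mulr_gt0.
move=> z z' Dz Dz' zz' j; rewrite /cube_retract.
have F01 := c0_extension01 i dxx dC dD f01.
have F1 := F01 z j; have F1' := F01 z' j.
have := snap_lip M0 (collapse_itv Dz) (collapse_itv Dz') F1 F1'.
move=> /le_lt_trans; apply.
have := c0_extension_unif dxx dC dD f01 z z' j m.
have := excess_unif dxx dC dD z z' m.
rewrite -mulrBr normrM (ger0_norm (x := 3))//.
have : d z z' / r < e / 2 / C by rewrite ltr_pdivrMr.
set u := `|excess _ _ _ _ - _|.
set v := `|c0_extension _ _ _ _ _ - _| => h hu hv.
have hC : e / 2 / C * C = e / 2 by rewrite mulfVK// gt_eqF.
have : (2 * v + 8 * M%:R * (3 * u)) <=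
    (4 + 24 * M%:R) * (e / 2 / C + d z z' / r).
  have : M%:R * u <= M%:R * (e / 2 / C + d z z' / r) by rewrite ler_pM2l.
  lra.
rewrite -(ler_pM2l Mgt0) => /le_lt_trans; apply.
rewrite mulrA -/C mulrDr (mulrC C (_ / C)) hC.
have : C * (d z z' / r) < C * (e / 2 / C) by rewrite ltr_pM2l.
by rewrite (mulrC C (_ / C)) hC; lra.
Qed.

End Retraction.

(** * Subspaces of the space of null families *)

Section Subspaces.
Context {R : realType} {J : countType}.
Implicit Types P : set (arrow_uniform_type J R).

Lemma entourage_subP P (E : set (P * P)) : entourage E <->
  exists2 e : R, 0 < e &
    forall x y : P, (forall j, `|set_val x j - set_val y j| < e) -> E (x, y).
Proof.
rewrite -(@entourage_ballE R); split=> -[e e0 h]; exists e => //.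
  by move=> x y; exact: (h (x, y)).
by move=> [x y]; exact: h.
Qed.

Let setval01 P (x : P) j : P `<=` c0_cube -> 0 <= set_val x j <= 1.
Proof. by move=> Pc; have [/(_ j)] := Pc _ (set_valP x). Qed.

(** The value 0 is added for the case of an empty index set. *)
Definition supdist P (x y : P) : R :=
  sup (0 |` range (fun j => `|set_val x j - set_val y j|)).

Lemma supdist_le P (x y : P) c : P `<=` c0_cube -> 0 <= c ->
  supdist x y <= c <-> forall j, `|set_val x j - set_val y j| <= c.
Proof.
move=> Pc c0; split=> [xyc j|xyc].
  apply: le_trans xyc; apply: ub_le_sup; last by right; exists j.
  exists 1 => _ [->//|[k _ <-]].
  have x01 := setval01 x k Pc.
  have y01 := setval01 y k Pc.
  by rewrite ler_norml; lra.
by apply: ge_sup => [|_ [->//|[j _ <-]]//]; exists 0; left.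
Qed.

Lemma supdist_ge0 P (x y : P) : P `<=` c0_cube -> 0 <= supdist x y.
Proof.
move=> Pc; apply: ub_le_sup; last by left.
exists 1 => _ [->//|[k _ <-]].
have x01 := setval01 x k Pc.
have y01 := setval01 y k Pc.
by rewrite ler_norml; lra.
Qed.

Lemma metrizable_sub P : P `<=` c0_cube -> metrizable R P.
Proof.
move=> Pc; exists (@supdist P); have d0 x y := supdist_ge0 x y Pc.
have dj (x y : P) j : `|set_val x j - set_val y j| <= supdist x y.
  exact: (supdist_le _ _ Pc (d0 x y)).1.
split.
- move=> x; apply/le_anti; rewrite d0 andbT; apply/supdist_le => // j.
  by rewrite subrr normr0.
- move=> x y xy0; apply: val_inj; apply/funext => j; apply/eqP.
  by rewrite -subr_eq0 -normr_eq0 eq_le normr_ge0 andbT -xy0; exact: dj.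
- have h (x y : P) : supdist x y <= supdist y x.
    by apply/(supdist_le _ _ Pc (d0 y x)) => j; rewrite distrC; exact: dj.
  by move=> x y; apply/le_anti; rewrite !h.
- move=> y x z; apply/(supdist_le _ _ Pc (addr_ge0 (d0 _ _) (d0 _ _))) => j.
  rewrite -(subrKA (set_val y j)); apply: le_trans (ler_normD _ _) _.
  exact: lerD.
- apply/seteqP; split=> E.
    move=> /entourage_subP[e e0 h]; exists e => // -[x y]/= xy; apply: h => j.
    exact: le_lt_trans (dj x y j) xy.
  move=> [e e0 h]; apply/entourage_subP; exists (e / 2) => [|x y xy].
    by rewrite divr_gt0.
  apply: h => /=; suff : supdist x y <= e / 2 by move: e0; rewrite /=; lra.
  by apply/supdist_le => // [|j]; [rewrite divr_ge0// ltW|rewrite ltW].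
Qed.

End Subspaces.

Section CompleteSeparable.
Context {R : realType} {J : countType}.
Implicit Types P : set (arrow_uniform_type J R).

(** The limit of a Cauchy filter is built coordinatewise as the supremum of the
    numbers that are eventually lower bounds; the Cauchy condition makes it a
    uniform limit. *)
Lemma complete_sub P :
  (forall y, (forall e : R, 0 < e ->
    exists2 p, P p & forall j, `|y j - p j| <= e) -> P y) ->
  complete_uniform P.
Proof.
move=> Pclosed F FF Fcauchy.
have F_ball e : 0 < e -> exists a : P,
    F [set x : P | forall j, `|set_val a j - set_val x j| < e].
  move=> e0; have : entourage [set xy : P * P |
      forall j, `|set_val xy.1 j - set_val xy.2 j| < e].
    by apply/entourage_subP; exists e.
  move=> /Fcauchy[[A B]/= [FA FB] AB]; have [a Aa] := filter_ex FA.
  by exists a; apply: filterS FB => x Bx; exact: (AB (a, x)).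
pose y j : R := sup [set c | F [set x : P | c <= set_val x j]].
have y_near e (a : P) :
    F [set x : P | forall j, `|set_val a j - set_val x j| < e] ->
    forall j, `|y j - set_val a j| <= e.
  move=> Fa j.
  have le_ub c : F [set x : P | c <= set_val x j] -> c <= set_val a j + e.
    move=> Fc; have [x [/(_ j)/= ax /= cx]] := filter_ex (filterI Fa Fc).
    by move: ax; rewrite ltr_norml; lra.
  have Fl : F [set x : P | set_val a j - e <= set_val x j].
    by apply: filterS Fa => x /(_ j); rewrite /= ltr_norml; lra.
  have : set_val a j - e <= y j.
    by apply: ub_le_sup => //; exists (set_val a j + e).
  have : y j <= set_val a j + e.
    by apply: ge_sup => //; exists (set_val a j - e).
  by rewrite ler_norml; lra.
have Py : P y.
  apply: Pclosed => e /F_ball[a /y_near ya].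
  by exists (set_val a) => //; exact: set_valP.
exists (SigSub (mem_set Py)).
apply/cvg_entourageP => E /entourage_subP[e e0 eE].
have [a Fa] := F_ball (e / 2) (divr_gt0 e0 (ltr0n _ 2)).
apply: filterS (Fa) => x /= ax; apply: eE => j.
suff : `|y j - set_val x j| < e by [].
by move: (ax j) (y_near _ _ Fa j); rewrite !ltr_norml ler_norml; lra.
Qed.

Fixpoint finite_rat (s : seq (J * rat)) (j : J) : R :=
  if s is (k, q) :: s' then if j == k then ratr q else finite_rat s' j else 0.

Lemma finite_rat_approx (y : J -> R) e : c0_cube y -> 0 < e ->
  exists s, forall j, `|y j - finite_rat s j| < e.
Proof.
move=> [y01 yv] e0; have [l lP] := yv e e0.
suff [s [sl s0]] : exists s,
    (forall j, j \in l -> `|y j - finite_rat s j| < e) /\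
    forall j, j \notin l -> finite_rat s j = 0.
  exists s => j; have [/sl//|jl] := boolP (j \in l).
  by rewrite s0// subr0 ger0_norm ?lP//; have /andP[] := y01 j.
elim: l {lP} => [|k l [s [sl s0]]]; first by exists [::].
have [|q] := @rat_in_itvoo R (y k - e) (y k + e); first by lra.
rewrite in_itv/= => qk; exists ((k, q) :: s); split=> j; rewrite inE /=.
  case: eqVneq => [->|_/= /sl//]; by rewrite ltr_norml; lra.
by case: eqVneq => //= _ /s0.
Qed.

(** Rational families of finite support approximate all points of the cube; one
    point of P is picked near each of them, at each scale 1/(n+1) for which
    there is one. *)
Lemma separable_sub P : P `<=` c0_cube -> separable P.
Proof.
move=> Pc; have [[p0]|P0] := pselect (exists p : P, True); last first.
  exists set0; first exact: countable0.
  by move=> O [x _]; case: P0; exists x.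
move=> _; pose close (t : seq (J * rat) * nat) : set P :=
  [set p | forall j, `|set_val p j - finite_rat t.1 j| < t.2.+1%:R^-1].
exists (range (fun t => xget p0 (close t))).
  exact: sub_countable (card_image_le _ _) (countableP _).
move=> O [x Ox] Oo; have : nbhs x O by exact: open_nbhs_nbhs.
rewrite -nbhs_entourageE => -[E /entourage_subP[e e0 eE] EO].
have [n ne] := ex_invn_lt (divr_gt0 e0 (ltr0n R 2)).
have n0 : 0 < n.+1%:R^-1 :> R by rewrite invr_gt0.
have [s sP] : exists s, forall j, `|set_val x j - finite_rat s j| < n.+1%:R^-1.
  by apply: finite_rat_approx => //; exact/Pc/set_valP.
have := @xgetPex _ p0 (close (s, n)) (ex_intro _ x sP); set p := xget _ _ => pP.
exists p; split; last by exists (s, n).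
apply: EO; apply/xsectionP; apply: eE => j.
have : `|set_val p j - finite_rat s j| < n.+1%:R^-1 := pP j.
have := sP j; rewrite !ltr_norml.
by move: (set_val x j) (set_val p j) (finite_rat s j) _^-1 ne => a b c k; lra.
Qed.

End CompleteSeparable.

(** * Unions of grid cubes are uniform ANRs *)

Lemma entourage_subtypeP (R : realType) (Z : uniformType) (d : Z -> Z -> R)
    (A : set Z) (E : set (A * A)) : metrizes d ->
  entourage E <-> exists2 e, 0 < e &
    forall x y : A, d (set_val x) (set_val y) < e -> E (x, y).
Proof.
move=> [_ _ _ _ dE]; split.
  move=> [V + VE]; rewrite dE => -[e e0 eV]; exists e => // x y xy.
  by apply: VE; exact: eV.
move=> [e e0 eE]; exists [set xy | d xy.1 xy.2 < e].
  by rewrite dE; exists e.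
by move=> [x y]; exact: eE.
Qed.

Section CubeANR.
Context {R : realType} {J : countType}.
Variables (M : nat) (K : set (arrow_uniform_type J R)).
Hypothesis M0 : (0 < M)%N.
Hypothesis Kc : K `<=` c0_cube.

Lemma uniform_ANR_cube_nbhd : uniform_ANR R (cube_nbhd M K).
Proof.
split; first by apply: metrizable_sub => y [].
move=> Z i [d dm] [h [h_unif [g [g_unif hK gK]]] hi] _.
have [dxx dS dC dD dE] := dm.
pose f (y : cube_nbhd M K) : arrow_uniform_type J R := set_val y.
have fN a : cube_nbhd M K (f a) by exact: set_valP.
have f_unif e : 0 < e -> exists r, modulus d i f e r.
  move=> e0; have /g_unif/(entourage_subtypeP _ dm)[r r0 gr] :
      entourage [set xy : cube_nbhd M K * cube_nbhd M K |
        forall j, `|set_val xy.1 j - set_val xy.2 j| < e].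
    by apply/entourage_subP; exists e.
  exists r; split=> // a b ab j; apply/ltW.
  by have /(_ _)/= := gr (h a) (h b); rewrite !hi !hK; exact.
exists (retract_domain M d i f).
  apply/(unif_neighborhood_metricP _ _ dm).
  have c0 : 0 < M%:R^-1 / 24 :> R by rewrite divr_gt0// invr_gt0 ltr0n.
  have [r m] := f_unif _ c0; have [_ r0 _] := m.
  exists (M%:R^-1 / 24 * r); first by rewrite mulr_gt0.
  move=> z [_ [a _ <-]]; rewrite -ltr_pdivrMr// => az.
  have aw : slack d i f z a (M%:R^-1 / 24 + d (i a) z / r).
    by exists (M%:R^-1 / 24), r.
  by rewrite /retract_domain/=; have := excess_le dxx dC dD aw; lra.
pose rho (u : retract_domain M d i f) : cube_nbhd M K :=
  SigSub (mem_set (cube_retract_in M0 Kc dxx dC dD fN f_unif (set_valP u))).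
exists (h \o rho); split.
  move=> E /h_unif/entourage_subP[e e0 eE]; apply/(entourage_subtypeP _ dm).
  have [r r0 rP] := cube_retract_unif M0 dxx dC dD fN f_unif e0.
  exists r => // x y xy; apply: eE => j.
  by apply: rP => //; exact: set_valP.
move=> u [a _ ia]; apply: etrans (hi (rho u)) _; apply: (etrans _ ia); congr i.
apply: val_inj; apply: etrans (cube_retract_ext M0 dxx dC dD fN f_unif a).
by rewrite ia.
Qed.

End CubeANR.

(** * The embedding of a separable space *)

Section AharoniEmbedding.
Context {R : realType} {X : Type}.
Variables (d : X -> X -> R) (q : nat -> X).
Hypothesis dC : forall x y, d x y = d y x.
Hypothesis dD : forall y x z, d x z <= d x y + d y z.
Hypothesis q_dense : forall x e, 0 < e -> exists n, d x (q n) < e.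

Let scale (k : nat) : R := k.+1%:R^-1.

Let scale_gt0 k : 0 < scale k :> R. Proof. by rewrite invr_gt0. Qed.

Let scale_le k l : (k <= l)%N -> scale l <= scale k :> R.
Proof. by move=> kl; rewrite lef_pV2 ?posrE// ler_nat. Qed.

Let d_lip x y z : `|d x z - d y z| <= d x y.
Proof.
have := dD y x z; have := dD x y z; rewrite (dC y x) ler_norml; lra.
Qed.

(** Positive exactly on the points of the e-ball about q_i that are farther than
    e/2 from all the earlier q_l; so at a given x only finitely many i count. *)
Definition shrunk_ball (e : R) (i : nat) (x : X) : R :=
  \big[Num.min/e - d x (q i)]_(l < i) (d x (q l) - e / 2).

Definition aharoni (x : X) : arrow_uniform_type (nat * nat)%type R :=
  fun ki => Num.max 0 (shrunk_ball (scale ki.1) ki.2 x).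

Lemma shrunk_ball_lip e i x y :
  `|shrunk_ball e i x - shrunk_ball e i y| <= d x y.
Proof.
apply: (big_ind2 (fun a b : R => `|a - b| <= d x y)).
- by rewrite (_ : _ - _ = d y (q i) - d x (q i)); [rewrite distrC d_lip|ring].
- move=> a b a' b'; rewrite /Order.min !ler_norml.
  by case: ltP => ?; case: ltP => ?; lra.
- move=> l _; rewrite (_ : _ - _ = d x (q l) - d y (q l)); last by ring.
  exact: d_lip.
Qed.

Lemma aharoni_lip x y j : `|aharoni x j - aharoni y j| <= d x y.
Proof.
have := shrunk_ball_lip (scale j.1) j.2 x y; rewrite /aharoni !ler_norml.
have : 0 <= d x y by have := d_lip x y x; apply: le_trans.
by rewrite /Order.max; case: ltP => ?; case: ltP => ?; lra.
Qed.

Lemma shrunk_ball_le e i x : shrunk_ball e i x <= e - d x (q i).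
Proof. by rewrite /shrunk_ball; apply: bigmin_le_id. Qed.

(** The tents of size 1/(k+1) < e are less than e everywhere.  For all of the
    finitely many larger sizes at once, a point q_i close enough to x makes the
    tents of index greater than i vanish at x. *)
Lemma aharoni_c0 x : c0_cube (aharoni x).
Proof.
have d0 y : 0 <= d x y by have := d_lip x y x; apply: le_trans.
have scale1 k : scale k <= 1 :> R by rewrite invf_le1 ?ler1n.
split=> [j|e e0].
  rewrite /aharoni le_max lexx/= ge_max ler01/=.
  have := shrunk_ball_le (scale j.1) j.2 x.
  by have := d0 (q j.2); have := scale1 j.1; lra.
have [n ne] := ex_invn_lt e0.
have [i xi] := q_dense x (divr_gt0 (scale_gt0 n) (ltr0n _ 2)).
exists [seq (k, l) | k <- iota 0 n, l <- iota 0 i.+1] => -[k l] kl.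
rewrite /aharoni gt_max e0/=.
have [nk|kn] := leqP n k.
  have := scale_le nk; have := ne; rewrite -/(scale n).
  have := shrunk_ball_le (scale k) l x; have := d0 (q l); lra.
have il : (i < l)%N.
  rewrite ltnNge; apply: contra kl => li.
  by apply/allpairsP; exists (k, l); rewrite !mem_iota/= add0n kn ltnS li.
have := scale_le (ltnW kn).
have := @bigmin_le _ R _ (scale k - d x (q l)) (Ordinal il)
  (fun m => d x (q m) - scale k / 2).
rewrite -/(shrunk_ball (scale k) l x) /=.
lra.
Qed.

(** Let i be least such that q_i is within 3/4 e of x, where e = 1/(k+1).  The
    i-th tent is at least e/4 at x because the earlier q_l are at least 3/4 e
    away, not just e/2; and it vanishes at distance 2 e or more from x. *)
Lemma aharoni_sep x y k :
  (forall j, `|aharoni x j - aharoni y j| < k.+1%:R^-1 / 4) ->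
  d x y < 2 * k.+1%:R^-1.
Proof.
rewrite -/(scale k).
have e0 := scale_gt0 k; move=> xy; rewrite ltNge; apply/negP => dxy.
have c0 : 0 < 3 / 4 * scale k by lra.
case: (ex_minnP (q_dense x c0)) => i xi imin.
have hx : scale k / 4 <= aharoni x (k, i).
  rewrite /aharoni le_max; apply/orP; right.
  apply: le_bigmin => [|l _]; first lra.
  rewrite leNgt; apply/negP => /= h.
  have /imin : d x (q l) < 3 / 4 * scale k by lra.
  by rewrite leqNgt ltn_ord.
have hy : aharoni y (k, i) = 0.
  apply/max_idPl; apply: le_trans (shrunk_ball_le _ _ _) _.
  by have := dD (q i) x y; rewrite (dC (q i)) /=; lra.
by have := xy (k, i); rewrite hy subr0 ltNge (le_trans hx)// ler_norm.
Qed.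

End AharoniEmbedding.

Section Embedding.
Context {R : realType} {X : uniformType}.
Variable d : X -> X -> R.
Hypothesis dm : metrizes d.

Lemma ex_c0_embedding : separable X ->
  exists phi : X -> arrow_uniform_type (nat * nat)%type R,
  [/\ forall x, c0_cube (phi x),
      forall x y j, `|phi x j - phi y j| <= d x y &
      forall e : R, 0 < e -> exists2 r : R, 0 < r & forall x y,
        (forall j, `|phi x j - phi y j| < r) -> d x y < e].
Proof.
have [dxx dS dC dD dE] := dm; move=> [D Dcount Ddense].
have ent_d e : 0 < e -> entourage [set xy : X * X | d xy.1 xy.2 < e].
  by move=> e0; rewrite dE; exists e.
have D_near x e : 0 < e -> exists2 y, D y & d x y < e.
  move=> e0; have [xO Ox] := open_nbhs_entourage x (ent_d e e0).
  have [y [yO Dy]] := Ddense _ (ex_intro _ x Ox) xO.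
  by exists y => //; have /xsectionP := interior_subset yO.
have [[x0]|X0] := pselect (exists x : X, True); last first.
  exists (fun _ _ => 0).
  by split=> [x|x|e e0]; [..|exists 1 => // x]; case: X0; exists x.
have [y0 Dy0 _] := D_near x0 1 ltr01.
move: Dcount => /pfcard_geP[D0|/unsquash q]; first by rewrite D0 in Dy0.
have q_dense x e : 0 < e -> exists n, d x (q n) < e.
  move=> /(D_near x)[y Dy xy]; have [n _ qn] := 'surj_q Dy.
  by exists n; rewrite qn.
exists (aharoni d q); split=> [x|x y j|e e0].
- exact: aharoni_c0.
- exact: aharoni_lip.
have [k ke] := ex_invn_lt (divr_gt0 e0 (ltr0n R 2)).
exists (k.+1%:R^-1 / 4) => [|x y xy]; first by rewrite divr_gt0// invr_gt0.
apply: lt_trans (aharoni_sep dC dD q_dense xy) _.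
by rewrite mulrC -ltr_pdivlMr.
Qed.

(** Preimages under phi of small balls about v form a Cauchy filter. *)
Lemma range_closed (phi : X -> arrow_uniform_type (nat * nat)%type R) v :
  complete_uniform X ->
  (forall x y j, `|phi x j - phi y j| <= d x y) ->
  (forall e : R, 0 < e -> exists2 r : R, 0 < r & forall x y,
    (forall j, `|phi x j - phi y j| < r) -> d x y < e) ->
  (forall e : R, 0 < e -> exists x, forall j, `|phi x j - v j| < e) ->
  exists x, phi x = v.
Proof.
have [dxx dS dC dD dE] := dm.
move=> Xc phi_lip phi_inv vK.
pose B (e : R) : set X := [set x | forall j, `|phi x j - v j| < e].
have FB : ProperFilter (filter_from [set e : R | 0 < e] B).
  apply: filter_from_proper => [|e /vK[x xv]]; last by exists x.
  apply: filter_from_filter; first by exists 1 => /=.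
  move=> e e' e0 e'0; exists (Num.min e e').
    by rewrite /= lt_min; apply/andP.
  by move=> x xB; split=> j; have := xB j; rewrite lt_min => /andP[].
have [|x Fx] := Xc _ FB.
  move=> E; rewrite dE => -[e e0 eE]; have [r r0 rP] := phi_inv e e0.
  have B2 : filter_from [set e : R | 0 < e] B (B (r / 2)).
    by exists (r / 2) => //=; rewrite divr_gt0.
  exists (B (r / 2), B (r / 2)) => // -[x y]/= [xB yB].
  apply: eE; apply: rP => j.
  by move: (xB j) (yB j); rewrite !ltr_norml; lra.
exists x; apply/funext => j; apply/eqP; rewrite -subr_eq0 -normr_le0.
apply/ler_addgt0Pr => e e0; rewrite add0r.
have e2 : 0 < e / 2 by rewrite divr_gt0.
have : entourage [set xy : X * X | d xy.1 xy.2 < e / 2].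
  by rewrite dE; exists (e / 2).
move=> /(nbhs_entourage x)/Fx[r r0 rB].
have m0 : 0 < Num.min r (e / 2) by rewrite lt_min r0.
have [y yv] := vK _ m0.
have /rB/xsectionP/= xy : B r y.
  by move=> k; have := yv k; rewrite lt_min => /andP[].
have := yv j; rewrite lt_min => /andP[_]; have := phi_lip x y j.
by rewrite ltr_norml !ler_norml; lra.
Qed.

End Embedding.

(** * Nested sequences and their telescopes *)

Section ProductUniformity.
Variable T : nat -> uniformType.

(** Minimality of the product uniformity, in the form of an induction
    principle. *)
Lemma entourage_prod_sub (G : set_system (prod_topology T * prod_topology T)) :
  Filter G ->
  (forall n (B : set (T n * T n)), entourage B ->
    G [set wz | B (wz.1 n, wz.2 n)]) ->
  entourage `<=` G.
Proof.
move=> FG Gproj V [W [F _ <-] WV]; apply: filterS WV _.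
apply: filter_bigI => -[[n A] /= /asboolP[B entB BA]] _.
by apply: filterS (Gproj n B entB); exact: BA.
Qed.

Lemma entourage_proj n (B : set (T n * T n)) : entourage B ->
  entourage [set wz : prod_topology T * prod_topology T | B (wz.1 n, wz.2 n)].
Proof.
move=> entB; set A := [set _ | _].
have pA : `[< @entourage (initial_topology (@proj _ T n)) A >].
  by apply/asboolP; exists B.
exists A => //.
(* The index type of the subbase has no name, so it is read off the goal. *)
match goal with |- @finI_from ?C _ _ ?g _ =>
  exact: (@finI_from1 C _ _ g
    (exist _ (n : {classic nat}, A) pA : Choice.sort C))
end.
Qed.

End ProductUniformity.

Section NestedSequence.
Context {R : realType} {J : countType}.
Variable A : nat -> set (arrow_uniform_type J R).
Variable f : forall n, A n.+1 -> A n.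
Hypothesis f_incl : forall n y, set_val (f (n := n) y) = set_val y.

Lemma nested_bonding_unif n : unif_continuous (f (n := n)).
Proof.
move=> E /entourage_subP[e e0 eE]; apply/entourage_subP; exists e => // x y xy.
by apply: eE => j; rewrite !f_incl.
Qed.

Lemma entourage_top_summand n
    (B : set (partial_union A n * partial_union A n)) :
  entourage B ->
  entourage [set xy : A n * A n | B (top_summand xy.1, top_summand xy.2)].
Proof.
case: n B => [|n] B; first by apply: filterS => -[].
by case.
Qed.

(** An entourage of the telescope constrains finitely many coordinates only.
    For large i, a point of A_i and a nearby point k of K give threads that
    agree up to a small error in all coordinates up to i, since the summand
    maps are uniformly continuous and the bonding maps are inclusions. *)
Lemma nested_convergent (K : set (arrow_uniform_type J R)) :
  (forall n, K `<=` A n) ->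
  (forall e : R, 0 < e -> \forall n \near \oo, forall y, A n y ->
    exists2 x, K x & forall j, `|x j - y j| < e) ->
  convergent f.
Proof.
move=> KA AK U [E [V entV VE] EU].
pose close e i (w z : prod_topology (partial_union A)) :=
  forall n, (n <= i)%N -> exists k x : A n,
    [/\ w n = top_summand k, z n = top_summand x &
    forall j, `|set_val k j - set_val x j| < e].
(* The relations that contain all close pairs form a filter to which the
   minimality of the product uniformity applies. *)
have [N [r r0 rV]] : exists N, exists2 r : R, 0 < r &
    forall i w z, (N <= i)%N -> close r i w z -> V (w, z).
  pose PU := prod_topology (partial_union A).
  pose G : set_system (PU * PU) :=
    [set V | exists N, exists2 r : R, 0 < r & forall i w z, (N <= i)%N ->
      close r i w z -> V (w, z)].
  have FG : Filter G.
    split.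
    - by exists 0%N, 1.
    - move=> P Q [N [r r0 rP]] [N' [r' r0' rQ]].
      exists (maxn N N'), (Num.min r r'); first by rewrite lt_min r0.
      move=> i w z; rewrite geq_max => /andP[Ni Ni'] wz.
      by split; [apply: (rP i)|apply: (rQ i)] => // n /wz[k [x [? ? kx]]];
        exists k, x; split=> // j; have := kx j; rewrite lt_min => /andP[].
    - move=> P Q PQ [N [r r0 rP]]; exists N, r => // i w z Ni wz.
      exact/PQ/(rP i).
  apply: (@entourage_prod_sub _ G FG) entV => n B.
  move=> /entourage_top_summand/entourage_subP[r r0 rB].
  exists n, r => // i w z ni /(_ n ni)[k [x [/= -> -> kx]]].
  exact: (rB k x).
have [M _ MK] := AK r r0.
exists (maxn N M) => // i /=; rewrite geq_max => /andP[Ni Mi] z [[x zx] _].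
have zlim : telescope_limit f (set_val z) := set_valP z.
have zx_below n : (n <= i)%N ->
    exists2 y : A n, set_val z n = top_summand y & set_val y = set_val x.
  move=> ni; rewrite -(subKn ni); elim: (i - n)%N (leq_subr n i) => [|m IH] mi.
    by rewrite subn0; exists x.
  have := IH (ltnW mi); rewrite -(subnSK mi) => -[y zy yx].
  exists (f y); last by rewrite f_incl.
  by rewrite -(zlim (i - m.+1)%N) zy.
have [k Kk kx] := MK i Mi _ (set_valP x).
pose y n : A n := SigSub (mem_set (KA n _ Kk)).
have ylim : inverse_limit f y by move=> n; apply: val_inj; exact: f_incl.
pose w : prod_topology (partial_union A) := fun n => top_summand (y n).
have wlim : telescope_limit f w.
  by move=> n; rewrite /w /= ylim.
apply: (EU (SigSub (mem_set wlim))); first by exists y.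
apply/xsectionP; apply: VE; apply: (rV i) => // n ni.
have [x' zx' x'x] := zx_below n ni; exists (y n), x'; split=> // j.
by rewrite x'x; exact: kx.
Qed.

End NestedSequence.

(** * The theorem *)

Theorem theorem16p2 (R : realType) (X : uniformType) :
  metrizable R X -> separable X -> complete_uniform X ->
  exists (Y : nat -> uniformType) (f : forall n : nat, Y n.+1 -> Y n),
    [/\ forall n, [/\ uniform_ANR R (Y n), separable (Y n) &
                      complete_uniform (Y n)],
        forall n, unif_continuous (f n),
        convergent f &
        unif_homeomorphic X (inverse_limit f)].
Proof.
move=> [d dm] Xsep Xcomp; have [dxx dS dC dD dE] := dm.
have [phi [phi_c0 phi_lip phi_inv]] := ex_c0_embedding dm Xsep.
pose K := range phi.
have Kc : K `<=` c0_cube by move=> _ [x _ <-].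
pose A n := cube_nbhd (2 ^ n) K.
have p2 n : (0 < 2 ^ n)%N by rewrite expn_gt0.
have AS n : A n.+1 `<=` A n by rewrite /A expnSr; exact: cube_nbhdM.
have KA n : K `<=` A n by exact: sub_cube_nbhd.
have AK (e : R) : 0 < e -> \forall n \near \oo, forall y, A n y ->
    exists2 x, K x & forall j, `|x j - y j| < e.
  move=> /ex_invn_lt[N Ne]; exists N => // n /= Nn y.
  move=> /(cube_nbhd_near (p2 n) Kc)[x Kx xy].
  exists x => // j; apply: le_lt_trans (xy j) _; apply: le_lt_trans Ne.
  rewrite lef_pV2 ?posrE ?ltr0n// ler_nat.
  exact: leq_ltn_trans Nn (ltn_expl n (ltnSn 1)).
pose f n (y : A n.+1) : A n := SigSub (mem_set (AS n _ (set_valP y))).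
have f_incl n (y : A n.+1) : set_val (f n y) = set_val y by [].
exists (fun n => A n : uniformType), f; split.
- move=> n; split.
  + exact: uniform_ANR_cube_nbhd.
  + by apply: separable_sub => y [].
  + by apply: complete_sub => y; exact: cube_nbhd_closed.
- move=> n; exact: nested_bonding_unif.
- exact: (nested_convergent f_incl KA AK).
have phi_inj x y : phi x = phi y -> x = y.
  move=> xy; apply: dS; apply/le_anti/andP; split; last first.
    by have := phi_lip x y (0, 0)%N; apply: le_trans.
  apply/ler_addgt0Pr => e e0; rewrite add0r; have [r r0 rP] := phi_inv e e0.
  by apply/ltW/rP => j; rewrite xy subrr normr0.
have Kphi x : K (phi x) by exists x.
have hlim x : inverse_limit f (fun n => SigSub (mem_set (KA n _ (Kphi x)))).
  by move=> n; apply: val_inj.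
have same_val (y : inverse_limit f) n :
    set_val (set_val y n) = set_val (set_val y 0%N).
  have ylim : inverse_limit f (set_val y) := set_valP y.
  by elim: n => // n <-; rewrite -(ylim n).
have ex_pre (y : inverse_limit f) : exists x, phi x = set_val (set_val y 0%N).
  apply: (range_closed dm) => // e /AK[N _ NA].
  have [_ [x _ <-] xy] := NA N (leqnn N) _ (set_valP (set_val y N)).
  by exists x => j; have := xy j; rewrite -(same_val y N).
pose h x : inverse_limit f := SigSub (mem_set (hlim x)).
pose g y : X := sval (cid (ex_pre y)).
have gE y : phi (g y) = set_val (set_val y 0%N) by rewrite /g; case: cid.
exists h; split.
  move=> E [V entV VE].
  apply: (filterS (P := [set xy | V (set_val (h xy.1), set_val (h xy.2))])).
    by move=> [x y]; exact: (VE (h x, h y)).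
  pose G := (fun xy : X * X => (set_val (h xy.1), set_val (h xy.2))) @ entourage.
  apply: (@entourage_prod_sub _ G _) entV => n B /entourage_subP[e e0 eB].
  rewrite /G /= dE; exists e => // -[x y] /= xy; apply: eB => j.
  exact: le_lt_trans (phi_lip x y j) xy.
exists g; split.
- move=> E; rewrite dE => -[e e0 eE]; have [r r0 rP] := phi_inv e e0.
  have entB : entourage [set xy : A 0%N * A 0%N |
      forall j, `|set_val xy.1 j - set_val xy.2 j| < r].
    by apply/entourage_subP; exists r.
  exists (fun wz => forall j, `|set_val (wz.1 0%N) j - set_val (wz.2 0%N) j| < r).
    exact: (entourage_proj entB).
  by move=> [y z] yz; apply: eE; apply: rP => j; rewrite !gE; exact: yz.
- by move=> x; apply: phi_inj; rewrite gE.
- move=> y; apply: val_inj; apply: functional_extensionality_dep => n.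
  apply: val_inj.
  by rewrite /= gE -(same_val y n).
Qed.
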